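(* Let $d\geq 1$ and $n\geq 1$ be integers. Then the following hold. (i) For every integer $k$, $$A_{d,k}=d!\cdot B_{d+1}(k).$$ (ii) For every integer $k$ and every integer $j$ with $0\leq j\leq d$, $$\mathbf{A}_{d+1,k,d-j+1}=\frac{d!\cdot[\lambda^j]\left((\lambda+1)^d\,B_{d+1}\!\left(k+\frac{1}{\lambda+1}\right)\right)}{\binom{d}{j}},\qquad \lambda\geq 0,$$ where the expression in the large parentheses is regarded as a function of $\lambda\ge 0$. (iii) For every integer $k$, $$D(d,n,k)=d!\cdot n^d\cdot B_{d+1}\!\left(k+\frac1n\right).$$
   Context: B splines: $B_1(x)=1$ if $x\in[0,1)$ and $B_1(x)=0$ otherwise; for $m\geq 2$, $B_m(x)=\int_0^1 B_{m-1}(x-t)\,dt$ for $x\in\mathbb{R}$. $S_d$ denotes the symmetric group on $\{1,\dots,d\}$, permutations being written as words $a_1a_2\cdots a_d$; a descent of such a permutation is an index $i\in\{1,\dots,d-1\}$ with $a_i>a_{i+1}$. The Eulerian number $A_{d,k}$ is the number of permutations in $S_d$ with exactly $k-1$ descents. The refined Eulerian number $\mathbf{A}_{d,k,j}$ is the number of permutations in $S_d$ with exactly $k$ descents and ending with the element $j$ (that is, $a_d=j$). Indexed permutations: for $n\geq1$, $S_d^n$ is the set of pairs $(a,z)$ where $a=a_1\cdots a_d\in S_d$ and $z=(z_1,\dots,z_d)\in\{0,1,\dots,n-1\}^d$ (each letter $a_i$ is assigned the index $z_i$). A descent of $(a,z)$ is an $i\in\{1,\dots,d\}$ such that $z_i>z_{i+1}$,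 or $z_i=z_{i+1}$ and $a_i>a_{i+1}$, with the convention $a_{d+1}=d+1$, $z_{d+1}=0$. $D(d,n,k)$ is the number of elements of $S_d^n$ with exactly $k$ descents. All these counting numbers are $0$ when $k$ is out of range. $[\lambda^j]f(\lambda)$ denotes the coefficient of $\lambda^j$ in the power series $f(\lambda)$; for a function of $\lambda\geq0$ it refers to the power series (here a polynomial) in $\lambda$ that represents the function on $[0,\infty)$. *)

(* Defs.v *)
From HB Require Import structures.
From mathcomp Require Import all_boot all_order all_algebra all_fingroup.
From mathcomp Require Import all_classical all_reals all_analysis.

Set Implicit Arguments.
Unset Strict Implicit.
Unset Printing Implicit Defensive.

Import Order.TTheory GRing.Theory Num.Theory.
Import numFieldNormedType.Exports.

Local Open Scope classical_set_scope.
Local Open Scope ring_scope.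

(* The splines are indexed from 1; the value at m = 0 is junk. *)
Fixpoint Bspline (R : realType) (m : nat) (x : R) : R :=
  match m with
  | 0 => 0
  | 1 => ((0 <= x) && (x < 1))%:R
  | m'.+1 => \int[@lebesgue_measure R]_(t in `[0, 1]) Bspline m' (x - t)
  end.

(* The word a_1 ... a_d of a permutation. 'I_d is {0, ..., d-1}, so letters are
   shifted to {1, ..., d}; positions remain 0-based, i.e. the letter a_(i+1) is
   nth 0 (word s) i. *)
Definition word (d : nat) (s : {perm 'I_d}) : seq nat :=
  [seq (nat_of_ord (s i)).+1 | i <- enum 'I_d].

Definition des (d : nat) (s : {perm 'I_d}) : nat :=
  #|[set i : 'I_d.-1 | (nth 0 (word s) i.+1 < nth 0 (word s) i)%N]%SET|.

(* The number of descents is compared in int, so that the counting numbers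
   vanish for k out of range. *)
Definition eulerian (d : nat) (k : int) : nat :=
  #|[set s : {perm 'I_d} | (des s)%:Z == k - 1]%SET|.

Definition refined_eulerian (d : nat) (k : int) (j : nat) : nat :=
  #|[set s : {perm 'I_d} | ((des s)%:Z == k) && (last 0%N (word s) == j)]%SET|.

Notation indexed_perm d n := ({perm 'I_d} * {ffun 'I_d -> 'I_n})%type.

(* The words of letters and of indices, extended by the convention
   a_(d+1) = d+1 and z_(d+1) = 0. *)
Definition ext_letters (d n : nat) (w : indexed_perm d n) : seq nat :=
  rcons (word w.1) d.+1.

Definition ext_indices (d n : nat) (w : indexed_perm d n) : seq nat :=
  rcons [seq nat_of_ord (w.2 i) | i <- enum 'I_d] 0%N.

Definition indexed_des (d n : nat) (w : indexed_perm d n) : nat :=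
  let a := nth 0%N (ext_letters w) in
  let z := nth 0%N (ext_indices w) in
  #|[set i : 'I_d | (z i.+1 < z i)%N ||
                    ((z i == z i.+1) && (a i.+1 < a i)%N)]%SET|.

Definition indexed_eulerian (d n : nat) (k : int) : nat :=
  #|[set w : indexed_perm d n | (indexed_des w)%:Z == k]%SET|.

(* Main.v *)
Require Import Defs.
From HB Require Import structures.
From mathcomp Require Import all_boot all_order all_algebra all_fingroup.
From mathcomp Require Import all_classical all_reals all_analysis.
From mathcomp Require Import zify ring lra.

Import Order.TTheory GRing.Theory Num.Theory.
Import numFieldNormedType.Exports.

Local Open Scope ring_scope.

(** On each interval [k, k + 1] the spline B_(d+1) is a polynomial of degree d,
    and the refined Eulerian numbers are its coefficients in the Bernstein
    basis: for 0 <= t <= 1 and d >= 1,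
<<
      d! B_(d+1)(k + t) = sum_j A_(d+1,k,d-j+1) C(d,j) (1 - t)^j t^(d-j)
>>
    (lemma [Bspline_piece]).  This is an induction on d in which both sides
    obey the same recurrence.
    - Analytically, B_(d+1)(k + t) integrates B_d over a window of length 1,
      which meets the piece k of B_d in [0, t] and the piece k - 1 in [t, 1].
      The primitive of (d+1) times a Bernstein polynomial of index j and
      degree d is the sum of those of index at most j and degree d + 1, and all
      Bernstein polynomials of a given degree sum to 1.  So the coefficient of
      index i of the new piece is a sum over j of old coefficients, those of
      the piece k if i <= j and those of the piece k - 1 if j < i.
    - Combinatorially, deleting the last letter r of a permutation and closing
      the gap loses one descent or none, according to whether the new last
      letter is at least r or not; this is the same recurrence
      ([refined_eulerian_rec]).

    The three formulas evaluate this identity.  With t = 1 / (lambda + 1) one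
    has 1 - t = lambda t, so multiplying by (lambda + 1)^d turns the Bernstein
    form into sum_j A_(d+1,k,d-j+1) C(d,j) lambda^j, which is (ii).  At
    lambda = 0 only the permutations ending with their largest letter remain,
    which gives (i).  At lambda = n - 1 it gives (iii), because D(d,n,k) is
    sum_j A_(d+1,k,d-j+1) C(d,j) (n - 1)^j ([indexed_eulerian_refined]).  For
    the latter, fix the index c(a) of every letter a, append the letter d + 1
    with index 0, and replace each letter by its rank for the order on the pairs
    (c(a), a): indexed permutations become ordinary permutations with the same
    descents whose last letter is one more than the number of zeros of c. *)

(** * Descents and deletion of the last letter *)

Lemma nth_word d (s : {perm 'I_d}) (i : 'I_d) :
  nth 0%N (word s) i = (s i).+1.
Proof. by rewrite (nth_map i) ?size_enum_ord // nth_ord_enum. Qed.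

Lemma last_word d (s : {perm 'I_d.+1}) : last 0%N (word s) = (s ord_max).+1.
Proof. by rewrite -nth_last size_map size_enum_ord -nth_word. Qed.

Lemma card_set_sum (T : finType) (P : pred T) :
  #|[set x | P x]%SET| = (\sum_x P x)%N.
Proof. by rewrite -sum1dep_card big_mkcond; apply: eq_bigr => x _; case: (P x). Qed.

(** [lift ord0 i] and [lift ord_max i] are the positions i + 1 and i, so that
    the two letters compared are values of the permutation itself. *)
Lemma des_sum d (s : {perm 'I_d.+1}) :
  des s = (\sum_(i < d) (s (lift ord0 i) < s (lift ord_max i))%N)%N.
Proof.
rewrite /des card_set_sum; apply: eq_bigr => i _; congr nat_of_bool.
have := nth_word _ s (lift ord0 i); rewrite lift0 => ->.
by have := nth_word _ s (lift ord_max i); rewrite lift_max => ->.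
Qed.

Lemma ltn_lift n (r : 'I_n.+1) (i j : 'I_n) : (lift r i < lift r j)%N = (i < j)%N.
Proof. by rewrite !ltnNge /= leq_bump2. Qed.

Lemma ltn_lift_self n (r : 'I_n.+1) (i : 'I_n) : (r < lift r i)%N = (r <= i)%N.
Proof. by rewrite /= /bump; case: leqP => h; lia. Qed.

(** [lift_perm ord_max r s] appends the letter r to s, the letters from r on
    being raised by one.  Raising keeps the order of the old letters; the old
    last letter ends above r exactly if it was at least r. *)
Lemma des_lift_perm d (s : {perm 'I_d.+1}) (r : 'I_d.+2) :
  des (lift_perm ord_max r s) = (des s + (r <= s ord_max))%N.
Proof.
rewrite !des_sum big_ord_recr /=; congr (_ + _)%N.
  apply: eq_bigr => i _.
  have -> : lift ord0 (widen_ord (leqnSn d) i) = lift ord_max (lift ord0 i) :> 'I_d.+2.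
    by apply: val_inj; rewrite /= /bump /=; move: (ltn_ord i); lia.
  have -> : lift ord_max (widen_ord (leqnSn d) i) = lift ord_max (lift ord_max i) :> 'I_d.+2.
    by apply: val_inj; rewrite /= /bump; move: (ltn_ord i); lia.
  by rewrite !lift_perm_lift ltn_lift.
have -> : lift ord0 ord_max = ord_max :> 'I_d.+2 by apply: val_inj.
by rewrite lift_perm_id lift_perm_lift ltn_lift_self.
Qed.

Lemma lift_perm_inj n (i j : 'I_n.+1) : injective (lift_perm i j).
Proof.
move=> s1 s2 e; apply/permP => x; apply: (@lift_inj _ j).
by rewrite -!(lift_perm_lift i) e.
Qed.

Lemma lift_perm_surj n (i j : 'I_n.+1) (s : {perm 'I_n.+1}) :
  s i = j -> exists t, s = lift_perm i j t.
Proof.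
move=> sij.
have nj x : j != s (lift i x) by rewrite -sij (inj_eq perm_inj) neq_lift.
pose f x := sval (unlift_some (nj x)).
have fE x : lift j (f x) = s (lift i x).
  by rewrite /f; case: unlift_some => /= y <-.
have f_inj : injective f.
  by move=> x y e; apply: (@lift_inj _ i); apply: (@perm_inj _ s); rewrite -!fE e.
exists (perm f_inj); apply/permP => x.
case: (unliftP i x) => [y|] ->; last by rewrite lift_perm_id.
by rewrite lift_perm_lift permE fE.
Qed.

(** Letters of a word are one more than the ordinals, hence [r.+1]. *)
Lemma refined_eulerianS d k (r : 'I_d.+2) :
  refined_eulerian d.+2 k r.+1 =
  #|[set s : {perm 'I_d.+1} | (des s + (r <= s ord_max)%N)%N%:Z == k]%SET|.
Proof.
rewrite -(card_imset _ (@lift_perm_inj _ ord_max r)); apply: eq_card => s.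
rewrite inE last_word eqSS; apply/andP/imsetP.
  move=> [/eqP ks /eqP /val_inj /lift_perm_surj [t e]].
  by exists t; rewrite // inE -des_lift_perm -e ks.
move=> [t]; rewrite inE => /eqP kt ->.
by rewrite des_lift_perm kt lift_perm_id !eqxx.
Qed.

(** Classifies the shortened permutations by their last letter; the indices
    count last letters from the top, as the Bernstein basis requires, so that
    the condition r <= s ord_max becomes j < i. *)
Lemma refined_eulerian_rec d k i : (i <= d.+1)%N ->
  refined_eulerian d.+2 k (d.+1 - i + 1) =
  (\sum_(j < d.+1) refined_eulerian d.+1 (if (i <= j)%N then k else k - 1)%R
                     (d - j + 1))%N.
Proof.
move=> id; have hr : (d.+1 - i < d.+2)%N by lia.
rewrite addn1 (refined_eulerianS _ _ (Ordinal hr)) -sum1dep_card.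
rewrite (partition_big (fun s : {perm 'I_d.+1} => rev_ord (s ord_max)) xpredT) //.
apply: eq_bigr => j _; rewrite sum1dep_card /refined_eulerian.
apply: eq_card => s; rewrite !inE last_word addn1 eqSS.
have -> : (rev_ord (s ord_max) == j) = (s ord_max == d - j :> nat)%N.
  apply/eqP/eqP => [<-|e]; last apply: val_inj;
  by move: (ltn_ord (s ord_max)) (ltn_ord j) => /=; lia.
rewrite andbC [RHS]andbC; case: eqP => //= ->.
by case: leqP => ?; case: leqP => ?; apply/eqP/eqP; move: (ltn_ord j); lia.
Qed.

Lemma refined_eulerian1 k : refined_eulerian 1 k 1 = (k == 0) :> nat.
Proof.
rewrite /refined_eulerian.
have D (s : {perm 'I_1}) : (des s)%:Z = 0 by rewrite des_sum big_ord0.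
have [->|k0] := eqVneq k 0.
  rewrite (_ : [set _ | _]%SET = [set: {perm 'I_1}]%SET); first by rewrite cardsT card_Sn.
  by apply/setP => s; rewrite !inE D eqxx last_word ord1.
apply/eqP; rewrite cards_eq0; apply/eqP/setP => s.
by rewrite !inE D eq_sym (negbTE k0).
Qed.

(** A largest letter at the end creates no descent.  The difference d - 0 is the
    index j = 0 of the general form of the last letter. *)
Lemma eulerianE d k : (0 < d)%N ->
  eulerian d k = refined_eulerian d.+1 (k - 1) (d - 0 + 1).
Proof.
case: d => // d _; rewrite subn0 addn1 (refined_eulerianS _ _ ord_max).
by apply: eq_card => s; rewrite !inE leqNgt ltn_ord addn0.
Qed.

(** * Indexed permutations *)

(** Here an index is attached to each letter rather than to each position: [c]
    sends a letter to its index, so the indices of the word s are c o s. *)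
Section Relabel.
Context {d n : nat} (c : {ffun 'I_d.+1 -> 'I_n.+1}).

Definition lexlt (a b : 'I_d.+1) := ((c a < c b) || ((c a == c b) && (a < b)))%N.

Lemma lexlt_trans : transitive lexlt.
Proof. by rewrite /lexlt => b a e; rewrite -!val_eqE /=; lia. Qed.

Lemma lexlt_irr a : lexlt a a = false.
Proof. by rewrite /lexlt !ltnn andbF. Qed.

Lemma lexlt_total a b : a != b -> lexlt a b || lexlt b a.
Proof. by rewrite /lexlt -!val_eqE /=; lia. Qed.

Definition lexdown b := [set a | lexlt a b]%SET.

Lemma lexrank_lt b : (#|lexdown b| < d.+1)%N.
Proof.
rewrite -[X in (_ < X)%N]card_ord -cardsT; apply: proper_card.
by apply/properP; split; [exact: finset.subsetT|exists b; rewrite ?inE ?lexlt_irr].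
Qed.

Definition lexrank b := Ordinal (lexrank_lt b).

Lemma lexrank_homo a b : lexlt a b -> (lexrank a < lexrank b)%N.
Proof.
move=> ab; apply: proper_card; apply/properP; split.
  by apply/fintype.subsetP => x; rewrite !inE => /lexlt_trans; apply.
by exists a; rewrite !inE ?lexlt_irr.
Qed.

Lemma lexrank_mono a b : (lexrank a < lexrank b)%N = lexlt a b.
Proof.
apply/idP/idP; last exact: lexrank_homo.
have [->|/lexlt_total /orP[//|/lexrank_homo]] := eqVneq a b; first by rewrite ltnn.
by lia.
Qed.

Lemma lexrank_inj : injective lexrank.
Proof.
move=> a b e; apply/eqP/negPn/negP => /lexlt_total.
by rewrite -!lexrank_mono e ltnn.
Qed.

Definition relabel := perm lexrank_inj.

Definition nzero := #|[set a | c a == ord0]%SET|.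

Lemma nzero_lt : (nzero < d.+2)%N.
Proof. by rewrite ltnS -[X in (_ <= X)%N]card_ord max_card. Qed.

(** The letter appended to an indexed word is the largest one of index 0, so its
    rank is the number of letters of index 0, and the letters after it in the
    lexicographic order are those with a nonzero index. *)
Lemma nzero_le_lexrank a : (nzero <= lexrank a)%N = (c a != ord0).
Proof.
have [ca|ca] := eqVneq (c a) ord0.
  apply/negbTE; rewrite -ltnNge; apply: proper_card; apply/properP; split.
    by apply/fintype.subsetP => x; rewrite !inE /lexlt ca ltn0 /= => /andP[].
  by exists a; rewrite !inE ?lexlt_irr ?ca.
apply: subset_leq_card; apply/fintype.subsetP => x; rewrite !inE /lexlt => /eqP ->.
by rewrite lt0n -val_eqE /= in ca *; rewrite ca.
Qed.

(** A descent of an indexed permutation is a descent for the lexicographic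
    order, which relabelling turns into the usual order; the appended letter
    becomes the last one of [lift_perm]. *)
Lemma indexed_des_relabel (s : {perm 'I_d.+1}) :
  indexed_des (s, [ffun i => c (s i)]) =
  des (lift_perm ord_max (Ordinal nzero_lt) (s * relabel)).
Proof.
rewrite des_lift_perm des_sum /indexed_des card_set_sum big_ord_recr /=.
have zE (i : 'I_d.+1) : nth 0%N (ext_indices (s, [ffun i => c (s i)])) i = c (s i).
  rewrite /ext_indices nth_rcons size_map size_enum_ord ltn_ord.
  by rewrite (nth_map i) ?size_enum_ord // nth_ord_enum ffunE.
have aE (i : 'I_d.+1) : nth 0%N (ext_letters (s, [ffun i => c (s i)])) i = (s i).+1.
  by rewrite /ext_letters nth_rcons size_map size_enum_ord ltn_ord nth_word.
congr (_ + _)%N.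
  apply: eq_bigr => i _; congr nat_of_bool.
  have := zE (lift ord0 i); have := aE (lift ord0 i); rewrite lift0 => -> ->.
  have := zE (lift ord_max i); have := aE (lift ord_max i).
  rewrite lift_max => -> ->; rewrite ltnS !permM !permE lexrank_mono /lexlt.
  by congr (_ || (_ && _)); rewrite -val_eqE eq_sym.
congr nat_of_bool; rewrite permM permE nzero_le_lexrank.
have := zE ord_max; have := aE ord_max => /= -> ->.
rewrite /ext_indices nth_rcons size_map size_enum_ord ltnn eqxx.
rewrite /ext_letters nth_rcons size_map size_enum_ord ltnn eqxx ltnS.
rewrite [X in _ && X]ltnNge (ltnW (ltn_ord (s ord_max))) andbF orbF lt0n.
by rewrite -val_eqE /=; case: eqP.
Qed.

(** For a fixed indexing, relabelling is a right translation of the symmetric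
    group, hence a bijection. *)
Lemma card_indexed_fiber k :
  #|[set s : {perm 'I_d.+1} |
      (indexed_des (s, [ffun i => c (s i)]))%:Z == k]%SET| =
  refined_eulerian d.+2 k nzero.+1.
Proof.
rewrite (refined_eulerianS _ _ (Ordinal nzero_lt)).
rewrite -(card_imset _ (mulIg relabel)); apply: eq_card => s.
rewrite inE -des_lift_perm; apply/imsetP/idP.
  by move=> [t]; rewrite inE indexed_des_relabel => /eqP <- ->.
move=> ks; exists (s * relabel^-1)%g; last by rewrite mulgKV.
by rewrite inE indexed_des_relabel mulgKV.
Qed.

End Relabel.

Lemma indexed_eulerian_sum d n k :
  indexed_eulerian d.+1 n.+1 k =
  (\sum_(c : {ffun 'I_d.+1 -> 'I_n.+1})
     refined_eulerian d.+2 k (nzero c).+1)%N.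
Proof.
rewrite /indexed_eulerian -sum1dep_card.
pose h (w : indexed_perm d.+1 n.+1) : {ffun 'I_d.+1 -> 'I_n.+1} :=
   [ffun a => w.2 ((w.1^-1)%g a)].
rewrite (partition_big h xpredT) //=; apply: eq_bigr => c _.
rewrite -card_indexed_fiber sum1dep_card.
pose g (s : {perm 'I_d.+1}) : indexed_perm d.+1 n.+1 := (s, [ffun i => c (s i)]).
have g_inj : injective g by move=> s t [].
rewrite -(card_imset _ g_inj); apply/esym/eq_card => -[s z]; rewrite !inE /=.
apply/imsetP/andP.
  move=> [t]; rewrite inE => kt [-> ->]; split=> //.
  by apply/eqP/ffunP => a; rewrite !ffunE /= permKV.
move=> [kz /eqP hc]; have ez : z = [ffun i => c (s i)].
  by apply/ffunP => i; rewrite -hc !ffunE /= permK.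
by exists s; rewrite /g ?inE -?ez.
Qed.

(** Generating function of the number of nonzero values: each letter
    contributes 1 for the index 0 and x for each of the n others. *)
Lemma sum_ffun_nonzero (K : comPzSemiRingType) d n (x : K) :
  \sum_(c : {ffun 'I_d.+1 -> 'I_n.+1}) x ^+ (d.+1 - nzero c) =
  (1 + x *+ n) ^+ d.+1.
Proof.
rewrite -[X in _ ^+ X]card_ord -prodr_const.
rewrite [RHS](eq_bigr (fun=> \sum_(z < n.+1) x ^+ (z != ord0))); last first.
  move=> i _; rewrite big_ord_recl eqxx expr0; congr (_ + _).
  by rewrite (eq_bigr (fun=> x)) ?sumr_const ?card_ord // => z _; rewrite expr1.
rewrite bigA_distr_bigA /=; apply: eq_bigr => c _.
rewrite prodrXr; congr (_ ^+ _).
rewrite /nzero card_set_sum -[X in (X - _)%N]card_ord -sum1_card /= -sumnB.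
  by apply: eq_bigr => a _; case: eqP.
by move=> a _; case: eqP.
Qed.

Lemma card_ffun_nonzero d n j :
  #|[set c : {ffun 'I_d.+1 -> 'I_n.+1} | (d.+1 - nzero c)%N == j]%SET| =
  ('C(d.+1, j) * n ^ j)%N.
Proof.
have /(congr1 (fun p : {poly int} => p`_j)) := sum_ffun_nonzero {poly int} d n 'X.
rewrite coef_sum exprDn coef_sum.
rewrite (eq_bigr (fun c : {ffun 'I_d.+1 -> 'I_n.+1} =>
   (d.+1 - nzero c == j)%N%:R)); last by move=> c _; rewrite coefXn eq_sym.
rewrite -natr_sum -card_set_sum => e; apply/eqP; rewrite -(@eqr_nat int) e.
rewrite (eq_bigr (fun i : 'I_d.+2 => ((i == j :> nat) * ('C(d.+1, i) * n ^ i))%N%:R)).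
  rewrite -natr_sum eqr_nat.
  have [jd|jd] := ltnP j d.+2.
    rewrite (bigD1 (Ordinal jd)) //= eqxx mul1n big1 ?addn0 // => i.
    by rewrite -val_eqE /= => /negbTE ->.
  rewrite bin_small // mul0n big1 // => i _.
  by rewrite ltn_eqF // (leq_trans (ltn_ord i)).
move=> i _; rewrite expr1n mul1r exprMn_n !coefMn coefXn eq_sym.
by rewrite -!mulrnA [(n ^ i * _)%N]mulnC.
Qed.

Lemma indexed_eulerian_refined d n k : (0 < d)%N ->
  indexed_eulerian d n.+1 k =
  (\sum_(j < d.+1) refined_eulerian d.+1 k (d - j + 1) * ('C(d, j) * n ^ j))%N.
Proof.
case: d => // d _; rewrite indexed_eulerian_sum.
pose nonzeros (c : {ffun 'I_d.+1 -> 'I_n.+1}) : 'I_d.+2 := inord (d.+1 - nzero c).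
have nonzerosE c : nonzeros c = (d.+1 - nzero c)%N :> nat.
  by rewrite inordK // ltnS leq_subr.
rewrite (partition_big nonzeros xpredT) //; apply: eq_bigr => j _.
rewrite (eq_bigr (fun=> refined_eulerian d.+2 k (d.+1 - j + 1))); last first.
  by move=> c /eqP <-; rewrite nonzerosE subKn ?addn1 // -ltnS; exact: nzero_lt.
rewrite -card_ffun_nonzero -sum1dep_card big_distrr /=.
by apply: eq_big => [c|c _]; rewrite ?muln1 // -val_eqE /= nonzerosE.
Qed.

(** * Bernstein polynomials *)

Section Bernstein.
Context {R : realType}.

Definition bernstein (d i : nat) : {poly R} :=
  ((1 - 'X) ^+ i * 'X^(d - i)) *+ 'C(d, i).

Lemma horner_bernstein d i (x : R) :
  (bernstein d i).[x] = ((1 - x) ^+ i * x ^+ (d - i)) *+ 'C(d, i).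
Proof. by rewrite hornerMn !hornerE. Qed.

Lemma deriv_bernstein d i :
  (bernstein d.+1 i.+1)^`() = (bernstein d i.+1 - bernstein d i) *+ d.+1.
Proof.
rewrite /bernstein derivMn derivM deriv_exp derivXn poly.derivB derivC derivX subSS.
rewrite sub0r mulN1r -subnS !mulNrn !mulNr mulrnAl mulrnAr.
rewrite addrC mulrnBl -!mulrnA ![(_ * 'C(d.+1, _))%N]mulnC.
have -> : ('C(d.+1, i.+1) * i.+1 = 'C(d, i) * d.+1)%N.
  by rewrite mulnC -mul_bin_diag mulnC.
have -> : ('C(d.+1, i.+1) * (d - i) = 'C(d, i.+1) * d.+1)%N.
  by rewrite mulnC -subSS -mul_bin_down mulnC.
by rewrite mulrnBl -!mulrnA.
Qed.

Definition cumbern (d j : nat) : {poly R} := \sum_(i < j.+1) bernstein d i.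

(** The derivatives of Bernstein polynomials telescope. *)
Lemma deriv_cumbern d j : (cumbern d.+1 j)^`() = bernstein d j *+ d.+1.
Proof.
elim: j => [|j IH].
  rewrite /cumbern big_ord1 /bernstein !expr0 !mul1r !bin0 !subn0 !mulr1n.
  by rewrite derivXn.
have -> : cumbern d.+1 j.+1 = cumbern d.+1 j + bernstein d.+1 j.+1.
  by rewrite /cumbern big_ord_recr.
by rewrite poly.derivD IH deriv_bernstein -mulrnDl addrC subrK.
Qed.

Lemma horner0_cumbern d j : (j < d)%N -> (cumbern d j).[0] = 0.
Proof.
move=> jd; rewrite horner_sum big1 // => i _.
rewrite hornerMn !hornerE expr0n subn_eq0 leqNgt.
by rewrite (leq_trans (ltn_ord i) jd) mulr0 mul0rn.
Qed.

Lemma horner1_cumbern d j : (cumbern d j).[1] = 1.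
Proof.
rewrite /cumbern big_ord_recl hornerD horner_sum big1 => [|i _].
  by rewrite addr0 hornerMn !hornerE expr1n bin0.
by rewrite hornerMn !hornerE subrr expr0n mul0r mul0rn.
Qed.

Lemma sum_bernstein d : \sum_(i < d.+1) bernstein d i = 1.
Proof.
rewrite -[RHS](expr1n _ d) -(subrK 'X 1) addrC exprDn; apply: eq_bigr => i _.
by rewrite /bernstein mulrC.
Qed.

(** * Integrals of piecewise polynomial functions *)

Lemma Rintegral_deriv (p : {poly R}) (a b : R) : a <= b ->
  \int[@lebesgue_measure R]_(x in `[a, b]) p^`().[x] = p.[b] - p.[a].
Proof.
rewrite le_eqVlt => /predU1P[->|ab].
  by rewrite set_itv1 Rintegral_set1 subrr.
rewrite /Rintegral (continuous_FTC2 (F := horner p)) //.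
- by apply: continuous_subspaceT; exact: continuous_horner.
- split.
  + by move=> x _; exact: derivable_horner.
  + by apply: cvg_at_right_filter; exact: continuous_horner.
  + by apply: cvg_at_left_filter; exact: continuous_horner.
- by move=> x _; rewrite derivE.
Qed.

Lemma integrable_horner (p : {poly R}) (a b : R) :
  (@lebesgue_measure R).-integrable `[a, b] (EFin \o horner p).
Proof.
apply: continuous_compact_integrable; first exact: segment_compact.
by apply: continuous_subspaceT; exact: continuous_horner.
Qed.

Lemma integrable_setU d (T : measurableType d) (mu : {measure set T -> \bar R})
    (A B : set T) (f : T -> \bar R) :
  measurable A -> measurable B -> [disjoint A & B]%classic ->
  mu.-integrable A f -> mu.-integrable B f -> mu.-integrable (A `|` B)%classic f.
Proof.
move=> mA mB AB iA iB; apply/integrable_mkcond; first exact: measurableU.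
rewrite (_ : (f \_ _)%E = ((f \_ A) \+ (f \_ B))%E).
  by apply: integrableD => //; [move/integrable_mkcond: iA|
                                move/integrable_mkcond: iB]; apply.
apply/funext => x; rewrite /patch in_setU /=.
have [/set_mem xA|] := boolP (x \in A); have [/set_mem xB|] := boolP (x \in B).
- by move/disj_setPS: AB => /(_ x (conj xA xB)).
- by rewrite adde0.
- by rewrite add0e.
- by rewrite adde0.
Qed.

(** The window [x - 1, x] over which a spline is averaged, for x = k + t: going
    back from x, the first part, of length t, lies in the interval starting at k
    and the rest in the previous one.  In local coordinates the two parts are
    [0, t] and [t, 1]. *)
Lemma Rintegral_window (f : R -> R) (p q : {poly R}) (t : R) : 0 <= t <= 1 ->
  (forall s, 0 <= s <= t -> f s = p^`().[t - s]) ->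
  (forall s, t < s <= 1 -> f s = q^`().[1 + t - s]) ->
  \int[@lebesgue_measure R]_(s in `[0, 1]) f s
    = p.[t] - p.[0] + (q.[1] - q.[t]).
Proof.
move=> /andP[t0 t1] fp fq.
(* Primitives in s: the reflection s |-> t - s accounts for the sign. *)
pose P := - (p \Po (t%:P - 'X)); pose Q := - (q \Po ((1 + t)%:P - 'X)).
have PE s : P^`().[s] = p^`().[t - s].
  by rewrite !poly.derivE deriv_comp !poly.derivE sub0r mulrN1 opprK horner_comp !hornerE.
have QE s : Q^`().[s] = q^`().[1 + t - s].
  by rewrite !poly.derivE deriv_comp !poly.derivE sub0r mulrN1 opprK horner_comp !hornerE.
have fP : {in `[0, t]%classic, f =1 horner P^`()}.
  by move=> s; rewrite inE /= in_itv /= => /fp; rewrite PE.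
have fQ : {in `]t, 1]%classic, f =1 horner Q^`()}.
  by move=> s; rewrite inE /= in_itv /= => /fq; rewrite QE.
have iP : (@lebesgue_measure R).-integrable `[0, t] (EFin \o f).
  have := integrable_horner P^`() 0 t.
  by apply: eq_integrable => // s /fP /= ->.
have iQ' : (@lebesgue_measure R).-integrable `]t, 1] (EFin \o horner Q^`()).
  have := integrable_horner Q^`() t 1; apply: integrableS => //.
  by apply: subset_itvr; rewrite bnd_simp.
have iQ : (@lebesgue_measure R).-integrable `]t, 1] (EFin \o f).
  by apply: eq_integrable iQ' => // s /fQ /= ->.
rewrite (_ : `[0, 1]%classic = (`[0, t] `|` `]t, 1])%classic); last first.
  by rewrite -itv_bndbnd_setU // bnd_simp.
have dis : [disjoint `[0%R, t] & `]t, 1%R]]%classic.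
  by apply/disj_setPS => s /= []; rewrite !in_itv /= => /andP[_ ?] /andP[? _]; lra.
rewrite Rintegral_setU //; last exact: integrable_setU.
transitivity (\int[@lebesgue_measure R]_(s in `[0, t]) P^`().[s] +
              \int[@lebesgue_measure R]_(s in `]t, 1]) Q^`().[s]).
  by congr (_ + _); exact: eq_Rintegral.
rewrite Rintegral_itv_obnd_cbnd //.
have PS s : P.[s] = - p.[t - s] by rewrite hornerN horner_comp !hornerE.
have QS s : Q.[s] = - q.[1 + t - s] by rewrite hornerN horner_comp !hornerE.
rewrite !Rintegral_deriv // !PS !QS subr0 subrr.
have -> : 1 + t - 1 = t by ring.
have -> : 1 + t - t = 1 by ring.
by ring.
Qed.

(** * The spline in Bernstein form *)

Definition bspline_coef (d : nat) (k : int) (j : nat) : R :=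
  (refined_eulerian d.+1 k (d - j + 1))%:R.

Definition bspline_piece (d : nat) (k : int) : {poly R} :=
  \sum_(j < d.+1) bspline_coef d k j *: bernstein d j.

(** Not the primitive of [bspline_piece d k] but d + 1 times it, which has no
    denominators. *)
Definition bspline_prim (d : nat) (k : int) : {poly R} :=
  \sum_(j < d.+1) bspline_coef d k j *: cumbern d.+1 j.

Lemma deriv_bspline_prim d k : (bspline_prim d k)^`() = bspline_piece d k *+ d.+1.
Proof.
rewrite /bspline_prim raddf_sum -sumrMnl; apply: eq_bigr => j _.
by rewrite /= derivZ deriv_cumbern scalerMnr.
Qed.

Lemma bspline_coefS d k i : (i <= d.+1)%N ->
  bspline_coef d.+1 k i = \sum_(j < d.+1) bspline_coef d (if (i <= j)%N then k else k - 1) j.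
Proof. by move=> id; rewrite /bspline_coef refined_eulerian_rec // natr_sum. Qed.

Lemma bspline_coef0 k : bspline_coef 0 k 0 = (k == 0)%:R.
Proof. by rewrite /bspline_coef subnn add0n refined_eulerian1. Qed.

(** The coefficient recurrence, read on polynomials: in the double sum over the
    indices i and j, the terms i <= j add up to a cumulative sum of Bernstein
    polynomials and the terms j < i to its complement to 1. *)
Lemma bspline_pieceS d k :
  bspline_piece d.+1 k =
  bspline_prim d k + \sum_(j < d.+1) bspline_coef d (k - 1) j *: (1 - cumbern d.+1 j).
Proof.
rewrite /bspline_piece /bspline_prim -big_split /=.
transitivity (\sum_(i < d.+2) \sum_(j < d.+1)
   bspline_coef d (if (i <= j)%N then k else k - 1) j *: bernstein d.+1 i).
  by apply: eq_bigr => i _; rewrite bspline_coefS -1?ltnS // scaler_suml.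
rewrite exchange_big; apply: eq_bigr => j _ /=.
rewrite (bigID (fun i : 'I_d.+2 => (i <= j)%N)) /=; congr (_ + _).
  rewrite (eq_bigr (fun i : 'I_d.+2 => bspline_coef d k j *: bernstein d.+1 i)).
    rewrite -scaler_sumr; congr (_ *: _).
    rewrite /cumbern (big_ord_widen d.+2 (bernstein d.+1)) //.
    by rewrite ltnS ltnW.
  by move=> i ->.
rewrite (eq_bigr (fun i : 'I_d.+2 => bspline_coef d (k - 1) j *: bernstein d.+1 i)).
  rewrite -scaler_sumr; congr (_ *: _).
  rewrite -(sum_bernstein d.+1) [X in _ = X - _](bigID (fun i : 'I_d.+2 => (i <= j)%N)) /=.
  rewrite /cumbern (big_ord_widen d.+2 (bernstein d.+1)).
    by apply/esym/eqP; rewrite subr_eq addrC.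
  by rewrite ltnS ltnW.
by move=> i /negbTE ->.
Qed.

Lemma horner0_bspline_prim d k : (bspline_prim d k).[0] = 0.
Proof. by rewrite horner_sum big1 // => j _; rewrite hornerZ horner0_cumbern ?mulr0. Qed.

Lemma horner_bspline_primB d k (t : R) :
  (bspline_prim d k).[1] - (bspline_prim d k).[t] =
  (\sum_(j < d.+1) bspline_coef d k j *: (1 - cumbern d.+1 j)).[t].
Proof.
rewrite !horner_sum -sumrB; apply: eq_bigr => j _.
by rewrite !hornerZ hornerD hornerN horner1_cumbern -polyC1 hornerC mulrBr.
Qed.

(** Continuity of the spline at the integer k + 1, for degrees at least 1. *)
Lemma bspline_piece_glue d k : (bspline_piece d.+1 k).[1] = (bspline_piece d.+1 (k + 1)).[0].
Proof.
by rewrite !bspline_pieceS !hornerD -!horner_bspline_primB subrr addrK !horner0_bspline_prim subr0 addr0 add0r.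
Qed.

Lemma BsplineS m (x : R) :
  Bspline m.+2 x = \int[@lebesgue_measure R]_(s in `[0, 1]) Bspline m.+1 (x - s).
Proof. by []. Qed.

(** The endpoint t = 1 is excluded because B_1 is discontinuous there. *)
Lemma Bspline_piece_lt1 d k (t : R) : 0 <= t < 1 ->
  (d`!)%:R * Bspline d.+1 (k%:~R + t) = (bspline_piece d k).[t].
Proof.
elim: d k t => [|d IH] k t /andP[t0 t1].
  rewrite /bspline_piece big_ord1 bspline_coef0 hornerZ /bernstein bin0 !expr0 !mul1r mulr1n.
  rewrite hornerE mulr1; congr _%:R; congr nat_of_bool.
  have [->|k0] := eqVneq k 0; first by rewrite add0r t0 t1.
  apply/negbTE/negP => /andP[h0 h1]; move/eqP: k0; apply.
  have : (-1)%:~R < k%:~R :> R by rewrite rmorphN /=; lra.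
  have : k%:~R < 1%:~R :> R by lra.
  by rewrite !ltr_int; lia.
have f0 m : (m`!)%:R != 0 :> R by rewrite pnatr_eq0 -lt0n fact_gt0.
(* Dividing by (d+1)! makes the scaled primitives those of the pieces of B_(d+1). *)
pose C : R := (d.+1`!)%:R.
have dC k' : (C^-1 *: bspline_prim d k')^`() = (d`!)%:R^-1 *: bspline_piece d k'.
  rewrite derivZ deriv_bspline_prim -scaler_nat scalerA /C factS natrM invfM.
  by rewrite mulrAC mulVf ?mul1r // pnatr_eq0.
rewrite BsplineS (Rintegral_window _ (C^-1 *: bspline_prim d k)
  (C^-1 *: bspline_prim d (k - 1)) t); first 1 last.
- by rewrite t0 ltW.
- move=> s /andP[s0 st]; rewrite dC hornerZ -IH ?mulKf ?addrA //.
  by apply/andP; split; lra.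
- move=> s /andP[s0 st]; rewrite dC hornerZ -IH; last by apply/andP; split; lra.
  rewrite mulKf // (intrD R k (-1)) intrN; congr (Bspline _ _); ring.
rewrite !hornerZ -!mulrBr -mulrDr mulrA divff ?f0 // mul1r.
by rewrite horner0_bspline_prim subr0 horner_bspline_primB bspline_pieceS hornerD.
Qed.

Lemma Bspline_piece d k (t : R) : (0 < d)%N -> 0 <= t <= 1 ->
  (d`!)%:R * Bspline d.+1 (k%:~R + t) = (bspline_piece d k).[t].
Proof.
case: d => // d _ /andP[t0]; rewrite le_eqVlt => /predU1P[->|t1].
  rewrite bspline_piece_glue -Bspline_piece_lt1 ?lexx ?ltr01 //.
  by rewrite addr0 intrD.
by rewrite Bspline_piece_lt1 // t0.
Qed.

(** For t = 1 / (l + 1) one has 1 - t = l t, so every Bernstein polynomial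
    becomes a monomial in l. *)
Lemma homogenize_bspline_piece d k (l : R) : 0 <= l ->
  (l + 1) ^+ d * (bspline_piece d k).[1 / (l + 1)] =
  \sum_(j < d.+1) bspline_coef d k j * 'C(d, j)%:R * l ^+ j.
Proof.
move=> l0; have l1 : l + 1 != 0 by apply/negP => /eqP; lra.
rewrite horner_sum mulr_sumr; apply: eq_bigr => j _.
rewrite hornerZ horner_bernstein !mul1r.
have -> : 1 - (l + 1)^-1 = l / (l + 1) by field.
have jd : (j <= d)%N by rewrite -ltnS.
rewrite -{1}(subnK jd) exprD expr_div_n exprVn -mulr_natr.
by field; rewrite !expf_neq0.
Qed.

End Bernstein.

Theorem theorem1p1 (R : realType) (d n : nat) (hd : (1 <= d)%N) (hn : (1 <= n)%N) :
  [/\ (forall k : int,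
         (eulerian d k)%:R = (d`!)%:R * Bspline d.+1 (k%:~R : R)),
      (* The power series in lambda is the polynomial p, which is determined
         by its values on the half-line 0 <= lambda. *)
      (forall k : int,
         exists p : {poly R},
           (forall lambda : R, 0 <= lambda ->
              p.[lambda] =
                (lambda + 1) ^+ d * Bspline d.+1 (k%:~R + 1 / (lambda + 1))) /\
           (forall j : nat, (j <= d)%N ->
              (refined_eulerian d.+1 k (d - j + 1)%N)%:R =
                (d`!)%:R * p`_j / ('C(d, j))%:R))
    & (forall k : int,
         (indexed_eulerian d n k)%:R =
           (d`!)%:R * (n%:R) ^+ d * Bspline d.+1 (k%:~R + 1 / n%:R : R))].
Proof.
have dilatedE k l : 0 <= l ->
    (\poly_(j < d.+1) (bspline_coef d k j * 'C(d, j)%:R / (d`!)%:R : R)).[l] =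
    (l + 1) ^+ d * Bspline d.+1 (k%:~R + 1 / (l + 1)).
  move=> l0; have f0 : (d`!)%:R != 0 :> R by rewrite pnatr_eq0 -lt0n fact_gt0.
  have l1 : 0 < l + 1 by lra.
  apply: (mulfI f0); rewrite mulrCA Bspline_piece //; last first.
    apply/andP; split; first by rewrite divr_ge0 // ltW.
    by rewrite ler_pdivrMr // mul1r; lra.
  rewrite homogenize_bspline_piece // horner_poly mulr_sumr; apply: eq_bigr => j _.
  by rewrite mulrA [_ * (_ / _)]mulrC divfK.
split.
- (* The integer k is taken as the right end k - 1 + 1 of its interval. *)
  move=> k; rewrite eulerianE // -{2}(subrK 1 k) rmorphD /=.
  rewrite Bspline_piece ?ler01 ?lexx //.
  have := homogenize_bspline_piece d (k - 1) (0 : R) (lexx _).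
  rewrite add0r expr1n mul1r divr1 => ->.
  rewrite big_ord_recl expr0 bin0 !mulr1 big1 ?addr0 // => j _.
  by rewrite expr0n mulr0.
- move=> k; exists (\poly_(j < d.+1) (bspline_coef d k j * 'C(d, j)%:R / (d`!)%:R)).
  split; first exact: dilatedE.
  move=> j jd; rewrite coef_poly ltnS jd [_ * (_ / _)]mulrC divfK.
    by rewrite mulfK // pnatr_eq0 -lt0n bin_gt0.
  by rewrite pnatr_eq0 -lt0n fact_gt0.
- move=> k; rewrite mulrAC Bspline_piece //; last first.
    apply/andP; split; first by rewrite divr_ge0 ?ler01 ?ler0n.
    by rewrite ler_pdivrMr ?ltr0n // mul1r ler1n.
  case: n hn => // m _; have := homogenize_bspline_piece d k _ (ler0n R m).
  rewrite -natr1 mulrC => ->; rewrite indexed_eulerian_refined // natr_sum.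
  by apply: eq_bigr => j _; rewrite -mulrA -natrX -!natrM.
Qed.
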